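(* Let $\mathcal{T}$ be a single-elimination tournament with $n$ players and let $U\subseteq V(\mathcal{T})$ be the set of vertices $u$ such that there is no $x\in N^+(u)$ with $N^-(x)=\{a,u\}$ for some player $a\in P(\mathcal{T})$. Then for every scoring system $\sigma$ of $\mathcal{T}$, \[\dim(\mathcal{T},\sigma)\le \min_{u\in U}\left( n-|P(u)|+\max\Big\{0,\ \dim(\mathcal{T}_u,\sigma_u)-\sum_{x\in M(\mathcal{T})\setminus M(\mathcal{T}_u)}\Big\lfloor \tfrac{|N^-(x)\cap (P(\mathcal{T})\setminus P(u))|}{2}\Big\rfloor\Big\}\right).\]
   Context: A single-elimination tournament is a finite directed graph $\mathcal{T}$ such that: (a) $\mathcal{T}$ has exactly one sink (vertex with no out-neighbours); (b) every non-sink vertex has exactly one out-neighbour; (c) $\mathcal{T}$ has no directed cycles; (d) $|N^-(v)|\ne 1$ for every vertex $v$, where $N^-(v)$ (resp. $N^+(v)$) denotes the set of in-neighbours (resp. out-neighbours) of $v$. The players $P(\mathcal{T})$ are the sources (vertices with no in-neighbours) and the matches are $M(\mathcal{T})=V(\mathcal{T})\setminus P(\mathcal{T})$. For a vertex $u$, $P(u)$ is the set of players $a$ for which there is a directed walk from $a$ to $u$ (a sequence $(u_1,\dots,u_t)$, $t\ge1$, $u_1=a$, $u_t=u$, $u_{i+1}\in N^+(u_i)$). For $u\in V(\mathcal{T})$, $\mathcal{T}_u$ is the digraph obtained from $\mathcal{T}$ by deleting every vertex $v$ with $P(v)\not\subseteq P(u)$; it is itself a single-elimination tournament, and $\sigma_u$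 is the restriction of $\sigma$ to $M(\mathcal{T})\cap V(\mathcal{T}_u)=M(\mathcal{T}_u)$. A bracket is a function $B:V(\mathcal{T})\to P(\mathcal{T})$ with $B(a)=a$ for every player $a$ and $B(x)\in\{B(u):u\in N^-(x)\}$ for every match $x$. A scoring system is any function $\sigma:M(\mathcal{T})\to\mathbb{R}_{>0}$. For brackets $B,B'$ let $\mathrm{score}_\sigma(B,B')=\sum_{x\in M(\mathcal{T}):\,B(x)=B'(x)}\sigma(x)$. A set of brackets $\mathcal{B}$ is $\sigma$-resolving if for every pair of distinct brackets $B\ne B'$ there is $B_i\in\mathcal{B}$ with $\mathrm{score}_\sigma(B_i,B)\ne\mathrm{score}_\sigma(B_i,B')$. $\dim(\mathcal{T},\sigma)$ denotes the minimum size of a $\sigma$-resolving set (with the same definitions applied to $(\mathcal{T}_u,\sigma_u)$). *)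

(* Defs.v *)
From mathcomp Require Import all_boot all_order all_algebra.
Set Implicit Arguments. Unset Strict Implicit. Unset Printing Implicit Defensive.
Import Order.TTheory GRing.Theory Num.Theory.

(* A finite digraph: vertex type T (finType), edge relation e (e x y = arc x -> y). *)
Section Defs.
Variables (T : finType) (e : rel T).

Definition inN (S : {set T}) (v : T) : {set T} := [set w in S | e w v].
Definition outN (v : T) : {set T} := [set w | e v w].

Definition playersS (S : {set T}) : {set T} := [set v in S | inN S v == set0].
Definition matchesS (S : {set T}) : {set T} := S :\: playersS S.

Definition players : {set T} := playersS setT.
Definition matches : {set T} := matchesS setT.

Definition is_SET : bool :=
  [&& #|[set v | outN v == set0]| == 1,
      [forall v, (outN v != set0) ==> (#|outN v| == 1)],
      [forall v, ~~ [exists w, e v w && connect e w v]] &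
      [forall v, #|inN setT v| != 1]].

Definition Pset (u : T) : {set T} := [set a in players | connect e a u].

Definition subT (u : T) : {set T} := [set v | Pset v \subset Pset u].

(* brackets of the induced subdigraph on S, normalised to be the identity
   outside S (so that brackets are determined by their values on S) *)
Definition is_bracket (S : {set T}) (B : {ffun T -> T}) : bool :=
  [&& [forall v, (v \notin S) ==> (B v == v)],
      [forall a in playersS S, B a == a] &
      [forall x in matchesS S, [exists w in inN S x, B x == B w]]].

Definition score (R : numDomainType) (S : {set T}) (sigma : T -> R)
  (B B' : {ffun T -> T}) : R :=
  \sum_(x in matchesS S | B x == B' x) sigma x.

Definition resolving (R : numDomainType) (S : {set T}) (sigma : T -> R)
  (Rs : {set {ffun T -> T}}) : bool :=
  (Rs \subset [set B | is_bracket S B]) &&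
  [forall B, forall B',
     [&& is_bracket S B, is_bracket S B' & B != B'] ==>
     [exists Bi in Rs, score S sigma Bi B != score S sigma Bi B']].

(* metric dimension: minimum size of a resolving set (the set of all
   brackets is resolving, so the default value is never attained) *)
Definition dimS (R : numDomainType) (S : {set T}) (sigma : T -> R) : nat :=
  \big[minn/#|{ffun T -> T}|]_(Rs : {set {ffun T -> T}} | resolving S sigma Rs) #|Rs|.

Definition Uset : {set T} :=
  [set u | ~~ [exists x in outN u, exists a in players, inN setT x == [set a; u]]].

End Defs.

(* Main.v *)
(** Call the players outside [P(u)] outer.  Within each match, pair off as many
of its outer players as possible; one member of each pair goes into a set [A].
Since [u] is in [U], every match outside [T_u] has some player of [A] below it,
so there is a bracket whose winners outside [T_u] all lie in [A]: the default.

For every outer player [b] take the bracket in which [b] wins all matches it can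
reach, the default decides the other matches outside [T_u], and some bracket of
[T_u] decides the rest, the latter being the same for the two members of a pair.
The difference of the scores of the two brackets of a pair [(a, a')] is the total
value of the matches won by [a] minus that of the matches won by [a'].  One of
them is zero because only one of [a], [a'] wins their common match, and the other
determines how far its player gets.  So the wins of all players of [A] are known,
hence the contribution of the default bracket, and each pair yields in addition
the score of a freely chosen bracket of [T_u].  If [T_u] needs more brackets than
there are pairs, they are added, completed by the default.  Once the outcome
inside [T_u] is known, the brackets of the unpaired outer players reveal their
wins too. *)

Require Import Defs.
From mathcomp Require Import all_boot all_order all_algebra.
From mathcomp Require Import lra.
Import Order.TTheory GRing.Theory Num.Theory.

Set Implicit Arguments.
Unset Strict Implicit.
Unset Printing Implicit Defensive.

(** * Pairing and distribution in finite sets *)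

(** Enumerate each fibre of [h] in [O]: its first half, rounded down, goes into [A], and [f] shifts
    the index by the size of that half, which stays within the fibre. *)
Lemma exists_half_matching (T : finType) (O : {set T}) (h : T -> T) :
  exists (A : {set T}) (f : T -> T),
    [/\ A \subset O,
        {in A &, injective f},
        {in A, forall a, f a \in O :\: A},
        {in A, forall a, h (f a) = h a} &
        forall x, #|[set a in A | h a == x]|
                  = #|[set a in O | h a == x]| %/ 2].
Proof.
pose K x := [set a in O | h a == x].
pose s x := enum (K x).
pose k x := #|K x| %/ 2.
have sz x : size (s x) = #|K x| by rewrite /s -cardE.
have k2 x : k x + k x <= size (s x).
  by rewrite sz addnn -muln2; apply: leq_divM.
have us x : uniq (s x) by apply: enum_uniq.
pose A := [set a in O | index a (s (h a)) < k (h a)].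
pose f a := nth a (s (h a)) (index a (s (h a)) + k (h a)).
have Abnd a : a \in A -> index a (s (h a)) + k (h a) < size (s (h a)).
  rewrite inE => /andP[_ ia]; apply: leq_trans (k2 _).
  by rewrite ltn_add2r.
have fK a : a \in A -> f a \in K (h a).
  by move=> aA; rewrite -mem_enum; apply: mem_nth; apply: Abnd.
have hf a : a \in A -> h (f a) = h a.
  by move=> /fK; rewrite inE => /andP[_ /eqP].
have idx a : a \in A -> index (f a) (s (h a)) = index a (s (h a)) + k (h a).
  by move=> aA; apply: index_uniq => //; apply: Abnd.
exists A, f; split.
- by apply/subsetP => a; rewrite inE => /andP[].
- move=> a b aA bA fab.
  have hab : h a = h b by rewrite -hf // -[h b]hf // fab.
  have := idx _ aA; rewrite fab hab idx // => /addIn iab.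
  have sa c : c \in A -> c \in s (h c).
    by rewrite mem_enum !inE => /andP[-> _] /=.
  by rewrite -(nth_index a (sa _ aA)) -(nth_index a (sa _ bA)) hab iab.
- move=> a aA; have := fK _ aA; rewrite !inE => /andP[fO _].
  by rewrite fO (hf _ aA) (idx _ aA) -ltnNge ltnS leq_addl.
- by move=> a; apply: hf.
move=> x; rewrite -/(K x) -/(k x).
have -> : [set a in A | h a == x] = [set a in take (k x) (s x)].
  apply/setP => a; rewrite !inE.
  have [<-|hax] /= := eqVneq (h a) x; last first.
    rewrite andbF; symmetry; apply/negP => /mem_take.
    by rewrite mem_enum inE (negbTE hax) andbF.
  rewrite andbT in_take_leq; last by apply: leq_trans (k2 _); rewrite leq_addl.
  have [aO|aO] //= := boolP (a \in O).
  symmetry; rewrite ltnNge; apply/negbTE; rewrite negbK.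
  rewrite memNindex; first by apply: leq_trans (k2 _); rewrite leq_addl.
  by rewrite mem_enum inE (negbTE aO).
rewrite cardsE (card_uniqP _) ?take_uniq // size_takel //.
by apply: leq_trans (k2 _); rewrite leq_addl.
Qed.

(** The brackets in [Rs] are dealt out one per pair [a], [f a]. If they run out, [c0] fills in; if
    pairs run out, the brackets left over form [R']. *)
Lemma exists_distribution (T U : finType) (A : {set T}) (f : T -> T)
    (Rs : {set U}) (c0 : U) :
  {in A &, injective f} -> {in A, forall a, f a \notin A} ->
  exists (c : T -> U) (R' : {set U}),
    [/\ forall b, c b = c0 \/ c b \in Rs,
        {in A, forall a, c (f a) = c a},
        Rs \subset [set c a | a in A] :|: R',
        R' \subset Rs &
        #|R'| <= #|Rs| - #|A|].
Proof.
move=> finj fA.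
pose g a := nth c0 (enum Rs) (index a (enum A)).
(* A partner [f a] looks up its unique preimage [a]. For elements outside [A] and its image the
   value is immaterial, so [odflt] may return anything. *)
pose c b := if b \in A then g b else g (odflt b [pick a in A | f a == b]).
have gP b : g b = c0 \/ g b \in Rs.
  rewrite /g; have [lt|ge] := ltnP (index b (enum A)) (size (enum Rs)).
    by right; rewrite -mem_enum mem_nth.
  by left; rewrite nth_default.
exists c, [set C in drop #|A| (enum Rs)]; split.
- by move=> b; rewrite /c; case: ifP.
- move=> a aA; rewrite /c (negbTE (fA _ aA)) aA.
  case: pickP => [a' /andP[a'A /eqP /finj ->] //|].
  by move/(_ a); rewrite aA eqxx.
- apply/subsetP => C CR; rewrite !inE.
  have CRs : C \in enum Rs by rewrite mem_enum.
  have := CRs; rewrite -{1}(cat_take_drop #|A| (enum Rs)) mem_cat.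
  case/orP => [Ct|->]; last by rewrite orbT.
  apply/orP; left; apply/imsetP.
  have iC : index C (enum Rs) < size (enum A).
    by rewrite -cardE; move/index_ltn: Ct.
  have /card_gt0P[x0 _] : 0 < #|A| by rewrite cardE; apply: leq_trans iC.
  exists (nth x0 (enum A) (index C (enum Rs))).
    by rewrite -mem_enum mem_nth.
  rewrite /c -mem_enum mem_nth // /g index_uniq ?enum_uniq //.
  by rewrite nth_index.
- by apply/subsetP => C; rewrite inE => /mem_drop; rewrite mem_enum.
by rewrite cardsE (card_uniqP _) ?drop_uniq ?enum_uniq // size_drop -cardE.
Qed.

(** * Reachability in the tournament tree *)

Section Tree.

Variables (T : finType) (e : rel T).
Hypothesis treeT : is_SET e.

Lemma arc_fun v w w' : e v w -> e v w' -> w = w'.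
Proof.
case/and4P: treeT => _ /forallP /(_ v) H _ _ vw vw'.
have /cards1P[z zE] : #|outN e v| == 1.
  by apply: (implyP H); apply/set0Pn; exists w; rewrite inE.
have : w \in outN e v by rewrite inE.
have : w' \in outN e v by rewrite inE.
by rewrite zE !inE => /eqP -> /eqP ->.
Qed.

Lemma arc_acyclic v w : e v w -> connect e w v = false.
Proof.
case/and4P: treeT => _ _ /forallP /(_ v) /existsP H _ vw.
by apply/negP => wv; apply: H; exists w; rewrite vw.
Qed.

Lemma connect_succ x y : connect e x y -> x != y ->
  exists2 z, e x z & connect e z y.
Proof.
case/connectP => [[|z p]] /= => [_ ->|/andP[xz zp] ->]; first by rewrite eqxx.
by exists z => //; apply/connectP; exists p.
Qed.

Lemma connect_pred x y : connect e x y -> x != y ->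
  exists2 z, connect e x z & e z y.
Proof.
case/connectP => p; case/lastP: p => [_ -> |p z]; first by rewrite eqxx.
rewrite rcons_path last_rcons => /andP[xp lz] -> _.
by exists (last x p) => //; apply/connectP; exists p.
Qed.

(** Out-neighbours are unique, so all walks from [a] run along one path. *)
Lemma connect_chain a x y :
  connect e a x -> connect e a y -> connect e x y || connect e y x.
Proof.
case/connectP => p; elim: p a => [a _ -> -> //|b p IH a /= /andP[ab bp] lx ay].
have [ya|nay] := eqVneq a y.
  by rewrite -ya; apply/orP; right; apply/connectP; exists (b :: p); rewrite //= ab.
have [z az zy] := connect_succ ay nay.
by apply: (IH b) => //; rewrite (arc_fun ab az).
Qed.

Lemma connect_antisym x y : connect e x y -> connect e y x -> x = y.
Proof.
move=> xy yx; apply/eqP/negPn/negP => nxy.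
have [z xz zy] := connect_succ xy nxy.
by have := arc_acyclic xz; rewrite (connect_trans zy yx).
Qed.

(** Both lie on the path from [a], so one reaches the other, say [w] reaches [w']. If they differ,
    that walk passes through [x], and the arc from [w'] to [x] closes a cycle. *)
Lemma connect_siblings a w w' x :
  e w x -> e w' x -> connect e a w -> connect e a w' -> w = w'.
Proof.
wlog ww' : w w' / connect e w w' => [H wx w'x aw aw'|wx w'x _ _].
  have [|/H H'] := orP (connect_chain aw aw') => [/H -> //|].
  by symmetry; apply: H'.
apply/eqP/negPn/negP => nww.
have [z wz zw'] := connect_succ ww' nww.
by have := arc_acyclic w'x; rewrite (arc_fun wx wz) zw'.
Qed.

Lemma connect_siblings_match a b p x :
  e a p -> e b p -> a != x -> connect e a x -> connect e b x.
Proof.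
move=> ap bp ax /connect_succ /(_ ax) [z az zx].
by rewrite (arc_fun az ap) in zx; apply: connect_trans zx; apply: connect1.
Qed.

(** Strictly increasing along arcs: the measure for induction from the players upwards. *)
Definition rank v := #|[set w | connect e w v]|.

Lemma rank_arc w x : e w x -> rank w < rank x.
Proof.
move=> wx; apply: proper_card; apply/properP; split.
  apply/subsetP => z; rewrite !inE => zw.
  by apply: connect_trans zw _; apply: connect1.
by exists x; rewrite !inE ?connect0 // arc_acyclic.
Qed.

Lemma tree_ind (P : T -> Prop) :
  (forall x, (forall w, e w x -> P w) -> P x) -> forall x, P x.
Proof.
move=> H x; have [n] := ubnP (rank x); elim: n x => // n IH x lex.
by apply: H => w /rank_arc lt; apply: IH; apply: leq_trans lt _; rewrite -ltnS.
Qed.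

Lemma playersP v : reflect (forall w, e w v = false) (v \in players e).
Proof.
rewrite !inE /=; apply: (iffP eqP) => [H w|H].
  by have := in_set0 w; rewrite -H !inE.
by apply/setP => w; rewrite !inE H.
Qed.

Lemma matchesE v : (v \in matches e) = (v \notin players e).
Proof. by rewrite /matches /matchesS in_setD in_setT andbT. Qed.

Lemma matches_child v : v \in matches e -> exists w, e w v.
Proof.
rewrite matchesE => H; apply/existsP; apply: contraR H => /existsPn H.
by apply/playersP => w; apply/negbTE.
Qed.

Lemma arc_match w v : e w v -> v \in matches e.
Proof. by move=> wv; rewrite matchesE; apply/playersP => /(_ w); rewrite wv. Qed.

Lemma match_two_children v w : e w v -> exists2 w', e w' v & w' != w.
Proof.
case/and4P: treeT => _ _ _ /forallP /(_ v) H wv.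
have wI : w \in inN e setT v by rewrite !inE.
have : 0 < #|inN e setT v :\ w|.
  by move: H; rewrite (cardsD1 w) wI lt0n add1n eqSS.
case/card_gt0P => w'; rewrite !inE => /andP[n w'v]; by exists w'.
Qed.

Lemma player_connect a x : a \in players e -> connect e x a -> x = a.
Proof.
move=> /playersP aP xa; apply/eqP/negPn/negP => n.
by have [z _] := connect_pred xa n; rewrite aP.
Qed.

Lemma PsetE a u : (a \in Pset e u) = (a \in players e) && connect e a u.
Proof. by rewrite inE. Qed.

Lemma Pset_sub x y : connect e x y -> Pset e x \subset Pset e y.
Proof.
move=> xy; apply/subsetP => a; rewrite !PsetE => /andP[-> ax] /=.
exact: connect_trans ax xy.
Qed.

(** * Brackets by greedy descent *)

Section Descent.

Variable Q : pred T.

Definition descend_step x :=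
  if [pick w | e w x && Q w] is Some w then w else
  if [pick w | e w x] is Some w then w else x.

(** The rank is at most [#|T|] and drops with each step from a match, so [#|T|] steps always end at
    a player, where the iteration stays. *)
Definition descent : {ffun T -> T} := [ffun x => iter #|T| descend_step x].

Lemma descend_step_arc x : x \in matches e -> e (descend_step x) x.
Proof.
case/matches_child => w wx; rewrite /descend_step.
case: pickP => [z /andP[] //|_]; case: pickP => // /(_ w).
by rewrite wx.
Qed.

Lemma descend_step_player x : x \in players e -> descend_step x = x.
Proof.
move/playersP => xP; rewrite /descend_step.
case: pickP => [z /andP[]|_]; first by rewrite xP.
by case: pickP => // z; rewrite xP.
Qed.

Lemma descent_player x : descent x \in players e.
Proof.
rewrite ffunE; have: rank x <= #|T| by apply: max_card.
elim: #|T| x => [|n IH] x.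
  by rewrite leqn0 cards_eq0 => /eqP /setP /(_ x); rewrite !inE connect0.
rewrite iterSr => le; have [xP|] := boolP (x \in players e).
  by rewrite descend_step_player // iter_fix // descend_step_player.
rewrite -matchesE => /descend_step_arc /rank_arc lt.
by apply: IH; rewrite -ltnS; apply: leq_trans lt le.
Qed.

Lemma descent_id x : x \in players e -> descent x = x.
Proof. by move=> xP; rewrite ffunE iter_fix // descend_step_player. Qed.

Lemma descent_stepE x : descent (descend_step x) = descent x.
Proof.
rewrite !ffunE -iterSr /= descend_step_player //.
by have := descent_player x; rewrite ffunE.
Qed.

Lemma descent_stable x :
  (forall y, y \in matches e -> Q y -> exists2 w, e w y & Q w) ->
  Q x -> Q (descent x).
Proof.
move=> QM Qx; rewrite ffunE; elim: #|T| => //= n.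
move: (iter n _ x) => y Qy; have [yP|] := boolP (y \in players e).
  by rewrite descend_step_player.
rewrite -matchesE => /QM /(_ Qy) [w wy Qw]; rewrite /descend_step.
by case: pickP => [z /andP[]//|/(_ w)]; rewrite wy Qw.
Qed.

End Descent.

(** * Brackets of down-closed vertex sets *)

(** Covers both the whole tournament and [subT e u]. Vertices of such a set keep all their
    in-neighbours, so its players and matches are those of the tournament that it contains. *)
Definition down_closed (S : {set T}) := forall w x, e w x -> x \in S -> w \in S.

Lemma down_closedT : down_closed setT.
Proof. by move=> w x _ _; rewrite in_setT. Qed.

Lemma playersSE S : down_closed S -> playersS e S = players e :&: S.
Proof.
move=> cS; apply/setP => v; rewrite in_setI /players /playersS !inE /= andbC.
have [vS|//] := boolP (v \in S); rewrite ?andbF //= !andbT; congr (_ == _).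
apply/setP => w; rewrite !inE /=.
by have [wv|] := boolP (e w v); rewrite ?andbF // (cS _ _ wv vS).
Qed.

Lemma matchesSE S : down_closed S -> matchesS e S = matches e :&: S.
Proof.
move=> cS; apply/setP => v; rewrite in_setI matchesE /matchesS playersSE //.
by rewrite in_setD in_setI negb_and; case: (v \in S); rewrite ?andbT ?andbF ?orbF.
Qed.

Lemma bracketP S (B : {ffun T -> T}) : down_closed S ->
  reflect [/\ forall v, v \notin S -> B v = v,
              forall a, a \in players e -> B a = a &
              forall x, x \in matches e -> x \in S -> exists2 w, e w x & B x = B w]
          (is_bracket e S B).
Proof.
move=> cS; rewrite /is_bracket playersSE // matchesSE //.
apply: (iffP and3P) => [[/forallP H1 /forall_inP H2 /forall_inP H3]|[H1 H2 H3]].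
  have out v : v \notin S -> B v = v by move=> vS; apply/eqP/(implyP (H1 v)).
  split=> // [a aP|x xM xS].
    have [aS|/out//] := boolP (a \in S).
    by apply/eqP/H2; rewrite inE aP.
  have /exists_inP[w] : [exists w in inN e S x, B x == B w].
    by apply: H3; rewrite inE xM.
  by rewrite inE => /andP[_ wx] /eqP; exists w.
split.
- by apply/forallP => v; apply/implyP => /H1 ->.
- by apply/forall_inP => a; rewrite inE => /andP[/H2 ->].
apply/forall_inP => x; rewrite inE => /andP[xM xS].
have [w wx Bw] := H3 _ xM xS; apply/exists_inP; exists w; last by apply/eqP.
by rewrite inE wx andbT; apply: cS wx xS.
Qed.

Lemma descent_bracket Q : is_bracket e setT (descent Q).
Proof.
apply/(bracketP _ down_closedT); split=> [v|a|x xM _]; first by rewrite in_setT.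
  exact: descent_id.
exists (descend_step Q x); first exact: descend_step_arc.
by rewrite descent_stepE.
Qed.

(** The identity outside [S] is the normalisation demanded by [is_bracket]. *)
Definition restr (S : {set T}) (B : {ffun T -> T}) : {ffun T -> T} :=
  [ffun x => if x \in S then B x else x].

Lemma restr_bracket S B : down_closed S ->
  is_bracket e setT B -> is_bracket e S (restr S B).
Proof.
move=> cS /(bracketP _ down_closedT) [_ B2 B3]; apply/bracketP => //; split.
- by move=> v vS; rewrite ffunE (negbTE vS).
- by move=> a aP; rewrite ffunE B2 ?if_same.
move=> x xM xS; have [w wx Bw] := B3 _ xM (in_setT _).
by exists w; rewrite // !ffunE xS (cS _ _ wx xS).
Qed.

(** * Paths of winners in a bracket *)

Section Bracket.

Variable B : {ffun T -> T}.
Hypothesis bB : is_bracket e setT B.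

Lemma bracket_player a : a \in players e -> B a = a.
Proof. by case/(bracketP _ down_closedT): bB => _ + _; apply. Qed.

Lemma bracket_match x : x \in matches e -> exists2 w, e w x & B x = B w.
Proof.
by case/(bracketP _ down_closedT): bB => _ _ H xM; apply: H; rewrite ?in_setT.
Qed.

Lemma bracket_Pset v : B v \in Pset e v.
Proof.
elim/tree_ind: v => v IH; have [vP|] := boolP (v \in players e).
  by rewrite bracket_player // PsetE vP connect0.
rewrite -matchesE => /bracket_match [w wv ->].
exact: (subsetP (Pset_sub (connect1 wv))) (IH _ wv).
Qed.

Lemma bracket_connect v : connect e (B v) v.
Proof. by have := bracket_Pset v; rewrite PsetE => /andP[]. Qed.

(** The winner of [x] comes from an in-neighbour that it reaches. By [connect_siblings] this is the
    one on the walk from [w], and induction continues there. *)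
Lemma bracket_below w x : connect e (B x) w -> connect e w x -> B w = B x.
Proof.
elim/tree_ind: x => x IH aw wx; have [->//|nwx] := eqVneq w x.
have [z wz zx] := connect_pred wx nwx.
have [y yx Bx] := bracket_match (arc_match zx).
have yz : y = z.
  apply: (connect_siblings yx zx) (bracket_connect y) _.
  by rewrite -Bx; apply: connect_trans aw wz.
by rewrite Bx; apply: IH yx _ _; [rewrite -Bx|rewrite yz].
Qed.

End Bracket.

(** If [u] were strictly below [v], take the in-neighbour [w] of [v] above [u] and a second one
    [w'], which exists as no in-degree is 1. A player below [w'] would reach [u], hence also [w],
    against [connect_siblings]. *)
Lemma subTE u v : (v \in subT e u) = connect e v u.
Proof.
rewrite inE; apply/idP/idP => [Pvu|]; last exact: Pset_sub.
(* Any bracket will do: it names a player below every vertex. *)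
have bW := descent_bracket pred0; set W := descent pred0 in bW.
have PW x : W x \in Pset e x by apply: bracket_Pset.
have Wv : connect e (W v) u.
  by have := subsetP Pvu _ (PW v); rewrite PsetE => /andP[].
have [//|uv] := orP (connect_chain (bracket_connect bW v) Wv).
have [->|nuv] := eqVneq u v; first exact: connect0.
have [w uw wv] := connect_pred uv nuv.
have [w' w'v nw] := match_two_children wv.
have : W w' \in Pset e u.
  by apply: (subsetP Pvu); apply: (subsetP (Pset_sub (connect1 w'v))).
rewrite PsetE => /andP[_ w'u].
have := connect_siblings w'v wv (bracket_connect bW w') (connect_trans w'u uw).
by move/eqP; rewrite (negbTE nw).
Qed.

Lemma subT_down_closed u : down_closed (subT e u).
Proof. by move=> w x wx; rewrite !subTE; apply: connect_trans; apply: connect1. Qed.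

Definition win_set (B : {ffun T -> T}) a := [set x in matches e | B x == a].

Lemma in_win_set B a x : (x \in win_set B a) = (x \in matches e) && (B x == a).
Proof. by rewrite in_set. Qed.

Definition win_score (R : realFieldType) (sigma : T -> R) B a := (\sum_(x in win_set B a) sigma x)%R.

(** The first match of a player. The default [x] for a sink is harmless: a player that is its own
    parent lies in no fibre over a match. *)
Definition parent x := odflt x [pick y | e x y].

Lemma parentE x y : e x y -> parent x = y.
Proof.
by rewrite /parent => xy; case: pickP => [z /(arc_fun xy)|/(_ y)] //; rewrite xy.
Qed.

Lemma parent_match a x : a \in players e -> x \in matches e ->
  (parent a == x) = e a x.
Proof.
move=> aP xM; apply/eqP/idP => [|/parentE //]; rewrite /parent.
case: pickP => [y ay <- //|_ /= ax].
by move: xM; rewrite -ax matchesE aP.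
Qed.

Lemma parent_arc a b : a \in players e -> b \in players e -> a != b ->
  parent a = parent b -> e a (parent a).
Proof.
move=> /playersP aP /playersP bP ab; rewrite /parent.
case: pickP => //= _; case: pickP => /= [y e_by ay|_ ab']; last by rewrite ab' eqxx in ab.
by move: e_by; rewrite -ay aP.
Qed.

(** * Default and champion brackets outside the subtournament *)

Section Outside.

Variables (u : T) (A : {set T}).
Hypothesis uU : u \in Uset e.

Let S := subT e u.
Let O := players e :\: Pset e u.

Hypothesis AO : A \subset O.
Hypothesis cardA : forall x,
  #|[set a in A | parent a == x]| = #|[set a in O | parent a == x]| %/ 2.

Let in_O a : (a \in O) = (a \in players e) && ~~ connect e a u.
Proof. by rewrite in_setD PsetE; case: (a \in players e); rewrite ?andbF ?andbT. Qed.

Let A_player a : a \in A -> a \in players e.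
Proof. by move/(subsetP AO); rewrite in_O => /andP[]. Qed.

Let notin_S x : (x \notin S) = ~~ connect e x u.
Proof. by rewrite subTE. Qed.

Definition covered v := [exists a in A, connect e a v].

Lemma covered_up x y : connect e x y -> covered x -> covered y.
Proof.
move=> xy /exists_inP[a aA ax]; apply/exists_inP; exists a => //.
exact: connect_trans ax xy.
Qed.

Lemma covered_pair x a b : x \in matches e -> a != b ->
  a \in O -> b \in O -> e a x -> e b x -> covered x.
Proof.
move=> xM ab aO bO ax bx.
have : 0 < #|[set a in A | parent a == x]|.
  rewrite cardA divn_gt0 //; apply: leq_trans (_ : #|[set a; b]| <= _).
    by rewrite cards2 ab.
  apply/subset_leq_card/subsetP => c; rewrite in_set2.
  by case/orP => /eqP ->; rewrite in_set (parentE ax, parentE bx) eqxx andbT.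
case/card_gt0P => c; rewrite inE => /andP[cA]; rewrite parent_match ?A_player //.
by move=> cx; apply/exists_inP; exists c => //; apply: connect1.
Qed.

(** Induction down the tree: either some in-neighbour is a match, again incomparable with [u], or
    two in-neighbours are outer players, and then [A] has a player in [x]. *)
Lemma covered_aside x : x \in matches e ->
  ~~ connect e x u -> ~~ connect e u x -> covered x.
Proof.
elim/tree_ind: x => x IH xM xu ux; have [w wx] := matches_child xM.
have [w' w'x nw] := match_two_children wx.
have child z : e z x -> ~~ connect e z u /\ ~~ connect e u z.
  move=> zx; split; last first.
    by apply: contra ux => uz; apply: connect_trans uz (connect1 zx).
  apply/negP => zu; have [zu'|nzu] := eqVneq z u.
    by rewrite -zu' connect1 in ux.
  have [y zy yu] := connect_succ zu nzu.
  by rewrite (arc_fun zx zy) yu in xu.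
have cov z : e z x -> z \in matches e -> covered x.
  move=> zx zM; have [zu uz] := child _ zx.
  exact: covered_up (connect1 zx) (IH _ zx zM zu uz).
have [wP|] := boolP (w \in players e); last by rewrite -matchesE; apply: cov.
have [w'P|] := boolP (w' \in players e); last by rewrite -matchesE; apply: cov.
apply: (covered_pair xM nw) => //; rewrite in_O ?wP ?w'P.
  by case: (child _ w'x).
by case: (child _ wx).
Qed.

(* Membership of u in U rules out exactly the case where the parent of u
   has a single player, hence no pair, as its only other child. *)
Lemma covered_match x : x \in matches e -> x \notin S -> covered x.
Proof.
rewrite notin_S => xM xu; have [ux|] := boolP (connect e u x); last first.
  exact: covered_aside.
have nux : u != x by apply: contraNneq xu => ->; apply: connect0.
have [p up px] := connect_succ ux nux.
apply: covered_up px _; have [w wp nwu] := match_two_children up.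
have side z : e z p -> z != u -> ~~ connect e z u /\ ~~ connect e u z.
  move=> zp nzu; split; apply/negP => c; move: nzu.
    by rewrite (connect_siblings zp up (connect0 e z) c) eqxx.
  by rewrite (connect_siblings zp up c (connect0 e u)) eqxx.
have cov z : e z p -> z != u -> z \in matches e -> covered p.
  move=> zp nzu zM; have [zu uz] := side _ zp nzu.
  exact: covered_up (connect1 zp) (covered_aside zM zu uz).
have [wP|] := boolP (w \in players e); last by rewrite -matchesE; apply: cov.
have [w' w'p nw'] : exists2 w', e w' p & w' \notin [set w; u].
  move: uU; rewrite inE => /existsPn /(_ p); rewrite inE up /=.
  move=> /existsPn /(_ w); rewrite wP /= => ne.
  have /subsetPn[w' ] : ~~ (inN e setT p \subset [set w; u]).
    apply: contra ne => sub; rewrite eqEsubset sub.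
    by apply/subsetP => z; rewrite !inE => /orP[] /eqP ->.
  by rewrite !inE /= => w'p; exists w'; rewrite // !inE.
move: nw'; rewrite !inE negb_or => /andP[nw'w nw'u].
have [w'P|] := boolP (w' \in players e); last by rewrite -matchesE; apply: cov.
apply: (covered_pair (arc_match up) nw'w) => //; rewrite in_O ?wP ?w'P.
  by case: (side _ w'p nw'u).
by case: (side _ wp nwu).
Qed.

Definition default := descent covered.

Lemma default_bracket : is_bracket e setT default.
Proof. exact: descent_bracket. Qed.

(** A covered match has a covered in-neighbour, so the descent never leaves the covered vertices,
    and a covered player belongs to [A]. *)
Lemma default_in x : x \in matches e -> x \notin S -> default x \in A.
Proof.
move=> xM xS; have /exists_inP[a aA] : covered (default x).
  apply: descent_stable (covered_match xM xS) => y yM /exists_inP[a aA ay].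
  have nay : a != y.
    by apply: contraTneq yM => <-; rewrite matchesE negbK A_player.
  have [z az zy] := connect_pred ay nay; exists z => //.
  by apply/exists_inP; exists a.
by move/(player_connect (descent_player _ _)) => <-.
Qed.

Lemma default_out x : x \notin S -> ~~ connect e (default x) u.
Proof.
move=> xS; have [xP|] := boolP (x \in players e).
  by rewrite /default descent_id // -notin_S.
rewrite -matchesE => /default_in /(_ xS) /(subsetP AO).
by rewrite in_O => /andP[].
Qed.

Definition champion b : {ffun T -> T} :=
  [ffun x => if connect e b x then b else default x].

Lemma champion_bracket b : b \in players e -> is_bracket e setT (champion b).
Proof.
move=> bP; apply/(bracketP _ down_closedT); split=> [v|a aP|x xM _].
- by rewrite in_setT.
- rewrite ffunE; case: ifP => [/(player_connect aP) //|_].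
  exact: (bracket_player default_bracket).
rewrite ffunE; case: ifP => [bx|/negbT bx].
  have nbx : b != x by apply: contraTneq xM => <-; rewrite matchesE negbK.
  by have [z bz zx] := connect_pred bx nbx; exists z; rewrite // ffunE bz.
have [w wx dw] := bracket_match default_bracket xM; exists w => //.
rewrite [champion b w]ffunE; case: ifP => // bw; case/negP: bx.
exact: connect_trans bw (connect1 wx).
Qed.

Lemma champion_out b x : b \in O -> x \notin S -> ~~ connect e (champion b x) u.
Proof.
rewrite in_O ffunE => /andP[_ bu] xS; case: ifP => // _; exact: default_out.
Qed.

Definition glue (V C : {ffun T -> T}) : {ffun T -> T} :=
  [ffun x => if x \in S then C x else V x].

(** Winners of [V] outside [S] never come from inside, so replacing the values on [S] disturbs no
    match outside. *)
Lemma glue_bracket V C : is_bracket e setT V ->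
  (forall x, x \notin S -> ~~ connect e (V x) u) ->
  is_bracket e S C -> is_bracket e setT (glue V C).
Proof.
move=> bV Vout /(bracketP _ (@subT_down_closed u)) [_ C2 C3].
apply/(bracketP _ down_closedT); split=> [v|a aP|x xM _].
- by rewrite in_setT.
- by rewrite ffunE C2 ?(bracket_player bV) ?if_same.
rewrite ffunE; case: ifP => [xS|/negbT xS].
  have [w wx Cw] := C3 _ xM xS; exists w => //.
  by rewrite ffunE (subT_down_closed wx xS).
have [w wx Vw] := bracket_match bV xM; exists w => //; rewrite ffunE.
case: ifP => // wS; case/negP: (Vout _ xS); rewrite Vw.
by apply: connect_trans (bracket_connect bV w) _; rewrite -subTE.
Qed.

(** * Scores of glued brackets *)

Section OutsideScores.

Variables (R : realFieldType) (sigma : T -> R) (B : {ffun T -> T}).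
Hypothesis bB : is_bracket e setT B.

Lemma score_glue V C :
  score e setT sigma (glue V C) B
  = (score e S sigma C (restr S B)
     + \sum_(x in matches e :\: S | V x == B x) sigma x)%R.
Proof.
rewrite /score -/(matches e) (bigID (mem S)) /=.
rewrite matchesSE; last exact: subT_down_closed.
congr (_ + _)%R; apply: eq_bigl => x; rewrite !ffunE /=.
  by rewrite in_setI; case: (x \in S); rewrite ?andbT ?andbF.
by rewrite in_setD; case: (x \in S); rewrite ?andbT ?andbF.
Qed.

(** The share of the default in the score of a glued [champion b]. *)
Definition residual b :=
  (\sum_(x in matches e :\: S | ~~ connect e b x && (default x == B x)) sigma x)%R.

(** In [B] the player [b] wins only matches that it reaches, and these lie outside [S] since [b] is
    outer; so [champion b] collects exactly the wins of [b] there. *)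
Lemma score_champion b C : b \in O ->
  score e setT sigma (glue (champion b) C) B
  = (score e S sigma C (restr S B) + (win_score sigma B b + residual b))%R.
Proof.
rewrite in_O => /andP[bP bu]; rewrite score_glue; congr (_ + _)%R.
rewrite (bigID (connect e b)) /=; congr (_ + _)%R; apply: eq_bigl => x.
  rewrite in_win_set in_setD ffunE.
  case: ifP => [bx|/negbT bx]; rewrite ?andbT ?andbF.
    rewrite [b == _]eq_sym; have [xS|//] := boolP (x \in S).
    by case/negP: bu; apply: connect_trans bx _; rewrite -subTE.
  symmetry; apply/andP => -[_ /eqP Bx]; case/negP: bx.
  by rewrite -Bx; apply: bracket_connect.
by rewrite ffunE; case: ifP => bx /=; rewrite ?andbT ?andbF.
Qed.

Lemma residual_siblings a b p : a \in players e -> b \in players e ->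
  e a p -> e b p -> residual a = residual b.
Proof.
move=> aP bP ap bp; apply: eq_bigl => x; rewrite in_setD.
have [xM|] := boolP (x \in matches e); last by rewrite !andbF.
have ne c : c \in players e -> c != x.
  by move=> cP; apply: contraTneq xM => <-; rewrite matchesE negbK.
suff -> : connect e a x = connect e b x by [].
by apply/idP/idP; apply: connect_siblings_match; rewrite ?ne //; eassumption.
Qed.

End OutsideScores.
End Outside.

(** * Recovering brackets from scores *)

Section Scores.

Variables (R : realFieldType) (sigma : T -> R).
Hypothesis sigma_gt0 : forall x, x \in matches e -> (0 < sigma x)%R.

Lemma sum_sigma_inj (A B : {set T}) : A \subset B -> B \subset matches e ->
  (\sum_(x in A) sigma x = \sum_(x in B) sigma x)%R -> A = B.
Proof.
move=> AB BM; rewrite [RHS](big_setID A) /= (setIidPr AB).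
rewrite -[LHS]addr0 => /addrI /esym s0.
apply/eqP; rewrite eqEsubset AB; apply/subsetP => x xB.
apply: contraT => xA; have xM := subsetP BM _ xB.
have sx : sigma x = 0%R.
  apply: (psumr_eq0P _ s0); last by rewrite inE xA.
  by move=> y; rewrite inE => /andP[_ /(subsetP BM) /sigma_gt0 /ltW].
by have := sigma_gt0 xM; rewrite sx ltxx.
Qed.

Lemma win_score_ge0 B a : (0 <= win_score sigma B a)%R.
Proof. by apply: sumr_ge0 => x; rewrite inE => /andP[/sigma_gt0 /ltW]. Qed.

(** The wins of [a] form an initial segment of the path from [a] to the sink, and two such segments
    are nested. With positive weights, the win score then determines the segment. *)
Lemma win_set_chain B B' a : is_bracket e setT B -> is_bracket e setT B' ->
  (win_set B a \subset win_set B' a) || (win_set B' a \subset win_set B a).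
Proof.
move=> bB bB'; apply: contraT; rewrite negb_or => /andP[/subsetPn[x xB xB']].
case/subsetPn => y yB' yB; move: xB xB' yB yB'; rewrite !in_win_set.
move=> /andP[xM /eqP Bx]; rewrite xM /= => B'x + /andP[yM /eqP B'y].
rewrite yM /= => By.
have ax : connect e a x by rewrite -Bx; apply: bracket_connect.
have ay : connect e a y by rewrite -B'y; apply: bracket_connect.
have [xy|yx] := orP (connect_chain ax ay).
  by rewrite -B'y (bracket_below bB' _ xy) ?eqxx ?B'y in B'x.
by rewrite -Bx (bracket_below bB _ yx) ?eqxx ?Bx in By.
Qed.

Lemma win_score_inj B B' a : is_bracket e setT B -> is_bracket e setT B' ->
  win_score sigma B a = win_score sigma B' a -> forall x, (B x == a) = (B' x == a).
Proof.
move=> bB bB' eqs x; have [xP|] := boolP (x \in players e).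
  by rewrite !bracket_player.
rewrite -matchesE => xM.
have wM C : win_set C a \subset matches e by apply/subsetP => y; rewrite inE => /andP[].
have /setP /(_ x) : win_set B a = win_set B' a.
  have [s|s] := orP (win_set_chain a bB bB'); first exact: sum_sigma_inj.
  by symmetry; apply: sum_sigma_inj.
by rewrite !in_win_set xM.
Qed.

(** A player with any win has won its first match, and [p] has only one winner. *)
Lemma win_score_siblings B a b p : is_bracket e setT B ->
  a \in players e -> b \in players e -> a != b -> e a p -> e b p ->
  win_score sigma B a = 0%R \/ win_score sigma B b = 0%R.
Proof.
move=> bB aP bP ab ap bp.
have won c : c \in players e -> e c p -> win_set B c != set0 -> B p = c.
  move=> cP cp /set0Pn[x]; rewrite inE matchesE => /andP[xM /eqP Bx].
  have cx : connect e c x by rewrite -Bx; apply: bracket_connect.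
  have ncx : c != x by apply: contraNneq xM => <-.
  have [z cz zx] := connect_succ cx ncx; rewrite (arc_fun cz cp) in zx.
  by rewrite -Bx; apply: bracket_below; rewrite // Bx connect1.
have [wa|/won wa] := eqVneq (win_set B a) set0.
  by left; rewrite /win_score wa big_set0.
have [wb|/won wb] := eqVneq (win_set B b) set0.
  by right; rewrite /win_score wb big_set0.
by case/eqP: ab; rewrite -wa // wb.
Qed.

(** [B] itself separates [B] from [B']: by positivity only full agreement attains the total
    value. *)
Lemma all_brackets_resolving S : down_closed S ->
  resolving e S sigma [set B | is_bracket e S B].
Proof.
move=> cS; rewrite /resolving subxx /=; apply/forallP => B; apply/forallP => B'.
apply/implyP => /and3P[bB bB' nB]; apply/exists_inP; exists B; first by rewrite inE.
apply: contra nB => /eqP sBB'.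
have MS : matchesS e S \subset matches e by rewrite matchesSE // subsetIl.
have /setP E : [set x in matchesS e S | B x == B' x] = matchesS e S.
  apply: sum_sigma_inj => //; first by apply/subsetP => x; rewrite inE => /andP[].
  transitivity (score e S sigma B B'); first by apply: eq_bigl => x; rewrite inE.
  by rewrite -sBB'; apply: eq_bigl => x; rewrite eqxx andbT.
case/(bracketP _ cS): bB => B1 B2 _; case/(bracketP _ cS): bB' => B1' B2' _.
apply/eqP/ffunP => x; have [xS|xS] := boolP (x \in S); last by rewrite B1 ?B1'.
have [xP|] := boolP (x \in players e); first by rewrite B2 ?B2'.
rewrite -matchesE => xM; have := E x; rewrite inE matchesSE // inE xM xS /=.
by move/eqP.
Qed.

Lemma dimS_le S Rs : resolving e S sigma Rs -> dimS e S sigma <= #|Rs|.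
Proof.
rewrite /dimS => rRs; have := mem_index_enum Rs.
elim: (index_enum _) => //= C r IH; rewrite inE big_cons => /predU1P[<-|/IH {}IH].
  by rewrite rRs geq_minl.
by case: ifP => // _; apply: leq_trans IH; apply: geq_minr.
Qed.

(** If the minimum is the default value in [dimS], the set of all brackets is a witness of at most
    that size. *)
Lemma dimS_attained S : down_closed S ->
  exists2 Rs, resolving e S sigma Rs & #|Rs| <= dimS e S sigma.
Proof.
move=> cS; rewrite /dimS; elim/big_ind: _ => [|m n [C rC Cm] [D rD Dn]|Rs rRs].
- by exists [set B | is_bracket e S B]; [apply: all_brackets_resolving|apply: max_card].
- by rewrite /minn; case: ifP => _; [exists C|exists D].
by exists Rs.
Qed.

(** * The resolving set and its size *)

Lemma glued_resolving u (A : {set T}) (f : T -> T) (Rs : {set {ffun T -> T}})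
    (c : T -> {ffun T -> T}) (R' : {set {ffun T -> T}}) :
  let S := subT e u in
  let O := players e :\: Pset e u in
  u \in Uset e -> A \subset O ->
  (forall x, #|[set a in A | parent a == x]|
             = #|[set a in O | parent a == x]| %/ 2) ->
  {in A, forall a, f a \in O :\: A} ->
  {in A, forall a, parent (f a) = parent a} ->
  resolving e S sigma Rs ->
  (forall b, is_bracket e S (c b)) ->
  {in A, forall a, c (f a) = c a} ->
  Rs \subset [set c a | a in A] :|: R' -> R' \subset Rs ->
  resolving e setT sigma
    ([set glue u (champion A b) (c b) | b in O]
     :|: [set glue u (default A) C | C in R']).
Proof.
move=> S O uU AO cardA fO hf /andP[/subsetP Rsb Rsr] cb cf RsC RRs.
have in_O a : (a \in O) = (a \in players e) && ~~ connect e a u.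
  by rewrite in_setD PsetE; case: (a \in players e); rewrite ?andbF ?andbT.
have OP a : a \in O -> a \in players e by rewrite in_O => /andP[].
apply/andP; split.
  apply/subsetP => G; rewrite in_setU inE => /orP[] /imsetP.
    case=> b bO ->; apply: glue_bracket => //; first by apply: champion_bracket; apply: OP.
    by move=> x; apply: champion_out.
  case=> C /(subsetP RRs) /Rsb; rewrite inE => bC ->.
  apply: glue_bracket => //; first exact: default_bracket.
  by move=> x; apply: default_out.
apply/forallP => B; apply/forallP => B'; apply/implyP => /and3P[bB bB' nB].
apply: contraR nB => /exists_inPn same.
have sameO b : b \in O ->
    score e setT sigma (glue u (champion A b) (c b)) B
    = score e setT sigma (glue u (champion A b) (c b)) B'.
  move=> bO; apply/eqP; rewrite -[_ == _]negbK; apply: same.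
  by rewrite inE; apply/orP; left; apply: imset_f.
(* Within a pair the two scores differ by the difference of the win scores,
   of which at most one is nonzero. *)
have winA a : a \in A -> win_score sigma B a = win_score sigma B' a.
  move=> aA; have aO := subsetP AO _ aA.
  have /setDP[faO faA] := fO _ aA.
  have afa : a != f a by apply: contraNneq faA => <-.
  have ap : e a (parent a).
    by apply: parent_arc afa _; rewrite ?OP ?hf.
  have fap : e (f a) (parent a).
    by rewrite -hf //; apply: (@parent_arc _ a); rewrite ?OP ?hf // eq_sym.
  have := sameO _ faO; have := sameO _ aO.
  rewrite !score_champion // cf // => E1 E2.
  have rE C : residual u A sigma C (f a) = residual u A sigma C a.
    by apply: residual_siblings fap ap; rewrite ?OP.
  rewrite !rE in E2.
  have D : (win_score sigma B a - win_score sigma B (f a)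
            = win_score sigma B' a - win_score sigma B' (f a))%R by lra.
  (* If the vanishing member differs between [B] and [B'], nonnegativity forces all four values to
     be zero. *)
  have := win_score_ge0 B a; have := win_score_ge0 B (f a).
  have := win_score_ge0 B' a; have := win_score_ge0 B' (f a).
  have [] := win_score_siblings bB (OP _ aO) (OP _ faO) afa ap fap;
  have [] := win_score_siblings bB' (OP _ aO) (OP _ faO) afa ap fap; lra.
have eqA a x : a \in A -> (B x == a) = (B' x == a).
  by move=> /winA E; apply: (win_score_inj bB bB' E).
(* Outside [S] the default names only players of [A], whose wins are already known. *)
have eqD x : x \in matches e :\: S -> (default A x == B x) = (default A x == B' x).
  rewrite in_setD => /andP[xS xM].
  by rewrite ![default A x == _]eq_sym; apply: eqA; apply: default_in xS.
have eqres b : residual u A sigma B b = residual u A sigma B' b.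
  apply: eq_bigl => x; have [xS|//] := boolP (x \in matches e :\: S).
  by rewrite eqD.
(* Each bracket of [Rs] was dealt to a pair or remains in [R']. In both cases the outside part of
   its glued score is the same for [B] and [B'] and cancels. *)
have eqS : restr S B = restr S B'.
  apply/eqP; move/forallP: Rsr => /(_ (restr S B)) /forallP /(_ (restr S B')).
  have cS := @subT_down_closed u.
  rewrite !restr_bracket //= => /implyP Rsr; apply/negPn/negP.
  move/Rsr => /exists_inP[C /(subsetP RsC)]; rewrite inE => /orP[/imsetP[a aA ->]|CR'].
    have := sameO _ (subsetP AO _ aA); rewrite !score_champion ?(subsetP AO) //.
    by rewrite eqres winA // => /addIr ->; rewrite eqxx.
  have /same : glue u (default A) C
      \in [set glue u (champion A b) (c b) | b in O]
     :|: [set glue u (default A) C | C in R'].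
    by rewrite inE; apply/orP; right; apply: imset_f.
  rewrite negbK !score_glue.
  have -> : (\sum_(x in matches e :\: subT e u | default A x == B x) sigma x
     = \sum_(x in matches e :\: subT e u | default A x == B' x) sigma x)%R.
    apply: eq_bigl => x; have [xS|//] := boolP (x \in matches e :\: _).
    by rewrite eqD.
  by move/eqP/addIr ->; rewrite eqxx.
(* With the inner score and the residual known, the win score of every outer player, paired or not,
   can be read off. *)
have eqO b x : b \in O -> (B x == b) = (B' x == b).
  move=> bO; apply: win_score_inj => //.
  have := sameO _ bO; rewrite !score_champion // -/S eqS eqres.
  by move/addrI/addIr.
have eqin x : x \in S -> B x = B' x.
  by move=> xS; have /ffunP/(_ x) := eqS; rewrite !ffunE xS.
apply/eqP/ffunP => x; have [/eqin//|xS] := boolP (x \in S).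
have [BO|BO] := boolP (B x \in O).
  by apply/esym/eqP; rewrite -eqO.
have [BO'|BO'] := boolP (B' x \in O).
  by apply/eqP; rewrite eqO.
have uS : u \in S by rewrite subTE connect0.
(* A winner at [x] that is not outer comes from below [u]; as [x] lies outside [S], its path to [x]
   passes through [u], which it also wins. *)
have viau C : is_bracket e setT C -> C x \notin O -> C x = C u.
  move=> bC; rewrite in_O; have := bracket_Pset bC x; rewrite PsetE.
  case/andP => -> Cx /=; rewrite negbK => Cu; symmetry; apply: bracket_below => //.
  by have := connect_chain Cu Cx; rewrite -[connect e x u]subTE (negbTE xS) orbF.
by rewrite (viau _ bB BO) (viau _ bB' BO'); apply: eqin.
Qed.

(** One bracket per outer player gives the first term, the leftover [R'] the second. Truncated
    subtraction expresses the maximum with 0. *)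
Lemma dimS_bound u : u \in Uset e ->
  (dimS e setT sigma <=
     #|players e| - #|Pset e u|
     + (dimS e (subT e u) sigma
        - \sum_(x in matches e :\: matchesS e (subT e u))
            (#|inN e setT x :&: (players e :\: Pset e u)| %/ 2)))%N.
Proof.
move=> uU; set S := subT e u; set O := players e :\: Pset e u.
have cS : down_closed S := @subT_down_closed u.
have [A [f [AO finj fO hf cardA]]] := exists_half_matching O parent.
have [Rs rRs cRs] := dimS_attained cS.
(* An arbitrary bracket of [S], the filler when there are more pairs than brackets. *)
have c0b := restr_bracket cS (descent_bracket pred0).
have fA : {in A, forall a, f a \notin A} by move=> a /fO /setDP[].
have [c [R' [cP cf RsC RRs cR']]] :=
  exists_distribution Rs (restr S (descent pred0)) finj fA.
have cb b : is_bracket e S (c b).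
  case/andP: rRs => /subsetP Rsb _.
  by have [->//|/Rsb] := cP b; rewrite inE.
apply: leq_trans (dimS_le (glued_resolving uU AO cardA fO hf rRs cb cf RsC RRs)) _.
apply: leq_trans (leq_card_setU _ _) _; apply: leq_add.
  apply: leq_trans (leq_imset_card _ _) _; rewrite -/O cardsD (setIidPr _) //.
  by apply/subsetP => a; rewrite PsetE => /andP[].
apply: leq_trans (leq_imset_card _ _) _; apply: leq_trans cR' _.
apply: leq_sub => //.
(* Split [A] by first matches. Only a lower bound on [#|A|] is needed, so fibres not over matches
   outside [S] are dropped. *)
have -> : #|A| = \sum_x #|[set a in A | parent a == x]|.
  rewrite -sum1_card (partition_big parent predT) //=; apply: eq_bigr => x _.
  by rewrite -sum1_card; apply: eq_bigl => a; rewrite inE.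
rewrite [leqRHS](bigID (mem (matches e :\: matchesS e S))) /=.
apply: leq_trans (leq_addr _ _); apply: leq_sum => x.
rewrite in_setD => /andP[_ xM]; rewrite cardA.
apply: leq_div2r; apply: subset_leq_card; apply/subsetP => a.
case/setIP => /setIdP[_ ax] aO.
by rewrite in_set aO (parentE ax) eqxx.
Qed.

End Scores.
End Tree.

Theorem theorem5p13 (T : finType) (e : rel T) (R : realFieldType) (sigma : T -> R) :
  is_SET e ->
  (forall x, x \in matches e -> 0 < sigma x)%R ->
  forall u, u \in Uset e ->
  (dimS e setT sigma <=
     #|players e| - #|Pset e u|
     + (dimS e (subT e u) sigma
        - \sum_(x in matches e :\: matchesS e (subT e u))
            (#|inN e setT x :&: (players e :\: Pset e u)| %/ 2)))%N.
Proof. by move=> treeT sigma_gt0 u; apply: dimS_bound. Qed.
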